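(* Let $\mathcal{H}$ be a complex infinite-dimensional Hilbert space, let $n>1$ be an integer, and let $A\in B(\mathcal{H})$ be such that $A^n$ is a normal operator. If $A$ is dominant, or if $A$ is of class $\mathcal{A}(1,1)$, then $A$ is normal.
   Context: $S\in B(\mathcal{H})$ is dominant if for every $\lambda\in\mathbb{C}$ there is a real $M_\lambda>0$ with $\|(S-\lambda)^*x\|\le M_\lambda\|(S-\lambda)x\|$ for all $x\in\mathcal{H}$. $S$ is of class $\mathcal{A}(1,1)$ if $|S|^2\le|S^2|$, where $|T|=(T^*T)^{1/2}$. *)

(* Defs.v *)
(* complex Hilbert spaces set up by honest definitions. *)
From mathcomp Require Import all_boot all_order all_algebra.
From mathcomp Require Import reals complex.
Set Implicit Arguments. Unset Strict Implicit. Unset Printing Implicit Defensive.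
Import Order.TTheory GRing.Theory Num.Theory.
Local Open Scope ring_scope.

Section Hilbert.
Variables (R : realType) (H : lmodType R[i]) (ip : H -> H -> R[i]).

(* norm induced by the inner product *)
Definition hnorm (x : H) : R := Num.sqrt (complex.Re (ip x x)).

(* ip is an inner product: linear in the first variable, conjugate symmetric,
   positive definite *)
Definition is_inner_product : Prop :=
  [/\ (forall (a : R[i]) (x y z : H), ip (a *: x + y) z = a * ip x z + ip y z),
      (forall x y : H, ip y x = (ip x y)^*),
      (forall x : H, 0 <= ip x x)
    & (forall x : H, ip x x = 0 -> x = 0)].

(* completeness for the induced norm *)
Definition hcomplete : Prop :=
  forall u : nat -> H,
    (forall e : R, 0 < e -> exists N : nat, forall m k : nat,
        (N <= m)%N -> (N <= k)%N -> hnorm (u m - u k) < e) ->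
    exists l : H, forall e : R, 0 < e -> exists N : nat, forall m : nat,
        (N <= m)%N -> hnorm (u m - l) < e.

Definition is_hilbert : Prop := is_inner_product /\ hcomplete.

(* bounded (= continuous) linear operators, i.e. elements of B(H) *)
Definition is_linear_op (T : H -> H) : Prop :=
  forall (a : R[i]) (x y : H), T (a *: x + y) = a *: T x + T y.

Definition bounded_op (T : H -> H) : Prop :=
  is_linear_op T /\ exists M : R, forall x : H, hnorm (T x) <= M * hnorm x.

(* Ts is the Hilbert adjoint T^* of T *)
Definition is_adjoint (T Ts : H -> H) : Prop :=
  forall x y : H, ip (T x) y = ip x (Ts y).

(* T is normal: T^* T = T T^* *)
Definition normal_op (T : H -> H) : Prop :=
  exists Ts : H -> H, is_adjoint T Ts /\ forall x : H, Ts (T x) = T (Ts x).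

(* S - lambda *)
Definition shift_op (S : H -> H) (l : R[i]) : H -> H := fun x => S x - l *: x.

(* dominant: for every lambda there is M > 0 with
   ||(S - lambda)^* x|| <= M ||(S - lambda) x|| *)
Definition dominant (S : H -> H) : Prop :=
  forall l : R[i], exists Ts : H -> H, is_adjoint (shift_op S l) Ts /\
    exists M : R, 0 < M /\
      forall x : H, hnorm (Ts x) <= M * hnorm (shift_op S l x).

(* positive operator: <P x, x> >= 0 for all x *)
Definition positive_op (P : H -> H) : Prop := forall x : H, 0 <= ip (P x) x.

(* class A(1,1): |S|^2 <= |S^2|, where |S|^2 = S^* S and |S^2| is the
   (unique) positive bounded square root of (S^2)^* S^2 = S^* S^* S S *)
Definition classA11 (S : H -> H) : Prop :=
  exists Ss : H -> H, is_adjoint S Ss /\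
    exists P : H -> H, [/\ bounded_op P, positive_op P,
      (forall x : H, P (P x) = Ss (Ss (S (S x))))
    & positive_op (fun x => P x - Ss (S x))].

End Hilbert.

(* H is infinite-dimensional: it contains k linearly independent vectors
   for every k *)
Definition infinite_dim (R : realType) (H : lmodType R[i]) : Prop :=
  forall k : nat, exists v : 'I_k -> H, forall c : 'I_k -> R[i],
    \sum_(j < k) c j *: v j = 0 -> forall j : 'I_k, c j = 0.

(* Main.v *)
(* Let [N = A^n] and [D = A A^* - A^* A].
   1. For [l <> 0], [|(A - l)^* x| <= M_l |(A - l) x|]: this is part of dominance, and
      for class A(1,1) it follows from a second order expansion of [|A^2 x|^2]. Hence
      [|D x| <= C_l |(A - l) x|].
   2. If [l_1, .., l_n] are the [n]-th roots of [mu <> 0], each [x] is a sum of [x_j] with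
      [(A - l_j) x_j] a multiple of [(N - mu) x], so [|D x| <= C_mu |(N - mu) x|] and
      [|D N x| <= C_mu |(N - mu) x|] for every [mu], including [0].
   3. For [N] normal this forces [D N = 0] (Putnam: the ranges of [N - mu] have trivial
      intersection). A vector [y] in all the ranges has a spectral measure integrating
      [|z - mu|^-2] for every [mu], while successive quartering of a square gives a point
      [mu] around which discs of radius [r] have measure at least of order [r^2]. Only
      polynomials in [N] and [N^*] are used: positivity on a square implies positivity
      of the operator, by joint approximate eigenvectors.
   4. Then [N D = 0], and since [A^2 x = 0] implies [A x = 0], successively [A D = 0],
      [A^* D = 0] and [D^2 = 0]. *)
From HB Require Import structures.
Require Import Defs.
From mathcomp Require Import all_boot all_order all_algebra.
From mathcomp Require Import boolp classical_sets reals complex.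
From mathcomp Require Import cyclic cyclotomic separable zify ring lra.
Set Implicit Arguments. Unset Strict Implicit. Unset Printing Implicit Defensive.
Import Order.TTheory GRing.Theory Num.Theory.
Local Open Scope ring_scope.

(** * Nested intervals, Bernoulli's inequality and roots of unity *)

Section NestedIntervals.
Local Open Scope classical_set_scope.

Lemma nested_point (R : realType) (lo hi : nat -> R) :
  (forall k, lo k <= lo k.+1) -> (forall k, hi k.+1 <= hi k) ->
  (forall k, lo k <= hi k) -> exists x, forall k, lo k <= x <= hi k.
Proof.
move=> lo_nd hi_ni lohi.
have loD j k : lo j <= lo (j + k)%N.
  by elim: k => [|k ih]; rewrite ?addn0// addnS (le_trans ih).
have hiD j k : hi (j + k)%N <= hi j.
  by elim: k => [|k ih]; rewrite ?addn0// addnS (le_trans _ ih).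
have ub k : ubound (range lo) (hi k).
  move=> _ [j _ <-]; apply: le_trans (loD j k) _.
  by rewrite addnC (le_trans (loD _ 0%N))// addn0 (le_trans (lohi _)).
exists (sup (range lo)) => k; apply/andP; split.
  by apply: ub_le_sup; [exists (hi 0%N)|exists k].
by apply: ge_sup => //; exists (lo 0%N); exists 0%N.
Qed.

End NestedIntervals.

Lemma bernoulli_ge (R : realDomainType) (x : R) j : 0 <= x <= 1 -> 1 - j%:R * (1 - x) <= x ^+ j.
Proof.
move=> /andP[x0 x1]; elim: j => [|j ih]; first by rewrite expr0 mul0r subr0.
have := exprn_ile1 j x0 x1; have : 0 <= j%:R :> R by [].
by rewrite exprS -natr1; nra.
Qed.

(** [X^n - 1] splits and, being separable in characteristic 0, has [n] distinct roots; [n] distinct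
    [n]-th roots of unity include a primitive one. *)
Lemma prim_root_exists (F : numClosedFieldType) n : (0 < n)%N -> exists z : F, n.-primitive_root z.
Proof.
move=> n0; have [r rE] := closed_field_poly_normal ('X^n - 1 : {poly F}).
rewrite (monicP _) ?monicXnsubC// scale1r in rE.
have /hasP[z _ zP] : has n.-primitive_root r; last by exists z.
apply: has_prim_root => //.
- by apply/allP => z; rewrite -root_prod_XsubC -rE.
- by rewrite -separable_prod_XsubC -rE separable_Xn_sub_1// pnatr_eq0 -lt0n.
- by have := size_prod_XsubC r id; rewrite -rE size_XnsubC// => -[->].
Qed.

(** The sum is geometric with ratio [z ^+ k], which differs from 1 while its [n]-th power is 1. *)
Lemma sum_prim_root (F : fieldType) n (z : F) k : n.-primitive_root z -> (0 < k < n)%N ->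
  \sum_(j < n) (z ^+ j) ^+ k = 0.
Proof.
move=> zP /andP[k0 kn].
have zk : z ^+ k - 1 != 0.
  by rewrite subr_eq0 -(prim_order_dvd zP); apply/negP => /(dvdn_leq k0); rewrite leqNgt kn.
apply: (mulfI zk); rewrite mulr0.
under eq_bigr => j _ do rewrite -exprM mulnC exprM.
by rewrite -subrX1 -exprM mulnC exprM (prim_expr_order zP) expr1n subrr.
Qed.

Lemma conjE (R : realType) (c : R[i]) : c^* = Complex (complex.Re c) (- complex.Im c)%R :> R[i].
Proof. by case: c. Qed.

Lemma Re_mul (R : realType) (c d : R[i]) : complex.Re (c * d) =
  complex.Re c * complex.Re d - complex.Im c * complex.Im d.
Proof. by case: c; case: d. Qed.

(** * Real inner product spaces *)

Section RealInnerProduct.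
Local Open Scope classical_set_scope.
Variables (R : realType) (V : lmodType R) (ip : V -> V -> R).
Hypothesis ipDl : forall x y z, ip (x + y) z = ip x z + ip y z.
Hypothesis ipZl : forall c x y, ip (c *: x) y = c * ip x y.
Hypothesis ipC : forall x y, ip x y = ip y x.
Hypothesis ip_ge0 : forall x, 0 <= ip x x.
Hypothesis ip_eq0 : forall x, ip x x = 0 -> x = 0.

Let q x := ip x x.

Lemma ipDr x y z : ip x (y + z) = ip x y + ip x z.
Proof. by rewrite ipC ipDl (ipC y) (ipC z). Qed.

Lemma ipZr c x y : ip x (c *: y) = c * ip x y.
Proof. by rewrite ipC ipZl ipC. Qed.

Lemma ipNl x y : ip (- x) y = - ip x y.
Proof. by rewrite -scaleN1r ipZl mulN1r. Qed.

Lemma ipNr x y : ip x (- y) = - ip x y.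
Proof. by rewrite ipC ipNl ipC. Qed.

Lemma ip0l x : ip 0 x = 0.
Proof. by rewrite -(scale0r (0 : V)) ipZl mul0r. Qed.

Definition ipE := (ipDl, ipDr, ipNl, ipNr, ipZl, ipZr).

Lemma sqnormZ c x : q (c *: x) = c ^+ 2 * q x.
Proof. by rewrite /q !ipE; ring. Qed.

Lemma sqnormD_le x y : q (x + y) <= 2 * q x + 2 * q y.
Proof. by have := ip_ge0 (x - y); rewrite /q !ipE (ipC y x); lra. Qed.

Lemma sqnormB_le x y : q (x - y) <= 2 * q x + 2 * q y.
Proof. by have := ip_ge0 (x + y); rewrite /q !ipE (ipC y x); lra. Qed.

Lemma ip_sqr_le x y : ip x y ^+ 2 <= q x * q y.
Proof.
(* The square expands to [q y] times the gap in the Cauchy-Schwarz inequality; definiteness settles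
   [q y = 0]. *)
have := ip_ge0 (q y *: x - ip x y *: y); rewrite !ipE (ipC y x) -!/(q _) => h.
have {}h : 0 <= q y * (q x * q y - ip x y ^+ 2) by move: h; lra.
have [qy0|qy0] := ltrP 0 (q y).
  by move: h; rewrite pmulr_rge0// subr_ge0.
have {}qy0 : y = 0 by apply: ip_eq0; apply/eqP; rewrite eq_le qy0 ip_ge0.
by rewrite qy0 /q ipC !ip0l expr0n mulr0.
Qed.

(** * Operators and approximate eigenvectors *)

Definition lin (T : V -> V) := forall c x y, T (c *: x + y) = c *: T x + T y.
Definition selfadjoint (T : V -> V) := forall x y, ip (T x) y = ip x (T y).
Definition bdd (T : V -> V) := exists M, forall x, q (T x) <= M * q x.

Lemma linD T x y : lin T -> T (x + y) = T x + T y.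
Proof. by move=> h; rewrite -{1}(scale1r x) h scale1r. Qed.

Lemma lin0 T : lin T -> T 0 = 0.
Proof. by move=> h; have := h 1 0 0; rewrite !scale1r addr0 => /esym/(canRL (addrK _)); rewrite subrr. Qed.

Lemma linZ T c x : lin T -> T (c *: x) = c *: T x.
Proof. by move=> h; have := h c x 0; rewrite (lin0 h) !addr0. Qed.

Lemma linB T x y : lin T -> T (x - y) = T x - T y.
Proof. by move=> h; rewrite linD// -scaleN1r linZ// scaleN1r. Qed.

Lemma bdd_ge0 T : bdd T -> exists2 M, 0 <= M & forall x, q (T x) <= M * q x.
Proof.
move=> [M hM]; exists `|M| => // x; apply: le_trans (hM x) _.
by rewrite ler_wpM2r ?ip_ge0 ?ler_norm.
Qed.

(** Expanding [|w - B z|^2 >= 0] bounds [2 B <w, z>] by [|w|^2 + B^2 |z|^2], which avoids square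
    roots. *)
Lemma ip_le_bound B z w : 0 < B -> q w <= B ^+ 2 * q z -> ip w z <= B * q z.
Proof.
move=> B0 h; have := ip_ge0 (w - B *: z); rewrite !ipE (ipC z w) -!/(q _) => k.
have : 2 * B * (ip w z) <= 2 * B * (B * q z) by nra.
by rewrite ler_pM2l//; lra.
Qed.

(* [s] is the lower limit of the quadratic form of [a] on vectors of vanishing
   relative defect [d]. Since the form of [g = a - s] is almost nonnegative there,
   testing it on [x - theta * g x] forces [g x] to be small. *)
Lemma approx_eigen (a : V -> V) (B : R) (d : V -> R) :
  lin a -> selfadjoint a -> 0 < B -> (forall x, q (a x) <= B ^+ 2 * q x) ->
  (forall (s : R) x, `|s| <= B ->
     d (x - (4 * B)^-1 *: (a x - s *: x)) <= 4 * d x) ->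
  (forall e : R, 0 < e -> exists2 x, 0 < q x & d x <= e * q x) ->
  exists s : R, [/\ `|s| <= B,
    forall e : R, 0 < e -> exists x,
      [/\ 0 < q x, d x <= e * q x & q (a x - s *: x) <= e * q x]
    & forall x, 0 < q x -> d x <= 0 -> s * q x <= ip (a x) x].
Proof.
move=> la sa B0 aB dP exd.
have aub x : ip (a x) x <= B * q x by apply: ip_le_bound.
have alb x : - B * q x <= ip (a x) x.
  have : ip (- a x) x <= B * q x by apply: ip_le_bound; rewrite // /q !ipE opprK; exact: aB.
  by rewrite ipNl; lra.
pose S : set R := [set r : R | exists2 e : R, 0 < e &
  forall x, d x <= e * q x -> r * q x <= ip (a x) x].
have SB : S (- B) by exists 1.
have Sub : ubound S B.
  move=> r [e e0 he]; have [x qx dx] := exd e e0.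
  by rewrite -(ler_pM2r qx) (le_trans (he x dx)).
have supS : has_sup S by split; [exists (- B)|exists B].
set s := sup S.
have sB : s <= B by apply: ge_sup => //; exists (- B).
have Bs : - B <= s by apply: ub_le_sup => //; exists B.
have s_abs : `|s| <= B by rewrite ler_norml Bs sB.
exists s; split => //; last first.
  move=> x qx dx; rewrite -ler_pdivlMr//; apply: ge_sup; first by exists (- B).
  move=> r [e e0 he]; rewrite ler_pdivlMr//; apply: he.
  by rewrite (le_trans dx)// mulr_ge0 ?ltW.
move=> e e0.
pose g x := a x - s *: x.
have lg : lin g by move=> c x y; rewrite /g la !scalerDr !scalerN !scalerA (mulrC s) opprD addrACA.
have sg : selfadjoint g by move=> x y; rewrite /g !ipE sa.
have qg x : q (g x) <= (2 * B) ^+ 2 * q x.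
  have h := sqnormB_le (a x) (s *: x); have := aB x; rewrite sqnormZ in h.
  have : s ^+ 2 <= B ^+ 2 by rewrite -real_normK ?num_real// lerXn2r// ?nnegrE// ltW.
  by have := ip_ge0 x; rewrite -/(q _); rewrite /g in h *; nra.
(* Since [|g| <= 2 B], the operator [th * g] has norm at most 1/2; so [q x] and [q (x - th *: g x)]
   are each at most 4 times the other. *)
pose th := (4 * B)^-1.
have th0 : 0 < th by rewrite invr_gt0; lra.
have thB : th * B = 4^-1 by rewrite /th; field; lra.
pose ga := e * th / 10.
have ga0 : 0 < ga by rewrite /ga; apply: divr_gt0 => //; apply: mulr_gt0.
have [e1 e10 he1] : exists2 e1 : R, 0 < e1 &
    forall x, d x <= e1 * q x -> - ga * q x <= ip (g x) x.
  have [r [e1 e10 he1] hr] := sup_adherent ga0 supS.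
  exists e1 => // x /he1 h; rewrite /g !ipE -!/(q _).
  by have := ip_ge0 x; rewrite -/(q _) -/s in hr *; nra.
(* The 16 absorbs [d x' <= 4 * d x] and [q x <= 4 * q x'], so that [he1] applies to [x']. *)
pose e2 := Num.min e (e1 / 16).
have e20 : 0 < e2 by rewrite lt_min e0 divr_gt0.
(* Otherwise [s + ga] would lie in [S], above its supremum. *)
have [x dx gx] : exists2 x, d x <= e2 * q x & ip (g x) x < ga * q x.
  apply: contrapT => hn; have : S (s + ga).
    exists e2 => // x dx; rewrite leNgt; apply/negP => hx; apply: hn; exists x => //.
    by rewrite /g !ipE -/(q _); lra.
  by move=> /(ub_le_sup (proj2 supS)); rewrite -/s; lra.
have qx : 0 < q x.
  rewrite lt_neqAle ip_ge0 andbT eq_sym; apply/eqP => qx0.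
  have := qg x; rewrite qx0 mulr0 => qgx.
  have := ip_sqr_le (g x) x; rewrite qx0 mulr0; rewrite qx0 mulr0 in gx.
  nra.
pose x' := x - th *: g x.
have qx' : q x <= 4 * q x'.
  have : q x <= 2 * q x' + 2 * q (th *: g x).
    by have := sqnormD_le x' (th *: g x); rewrite /x' subrK.
  rewrite sqnormZ; have := qg x; have : th ^+ 2 * ((2 * B) ^+ 2 * q x) = q x / 4.
    by transitivity ((th * B) ^+ 2 * 4 * q x); [ring|rewrite thB; field].
  have := sqr_ge0 th; nra.
have dx' : d x' <= e1 * q x'.
  apply: le_trans (dP s x s_abs) _.
  have : e2 <= e1 / 16 by rewrite ge_min lexx orbT.
  nra.
have h1 := he1 _ dx'.
have qx'' : q x' <= 4 * q x.
  have := sqnormB_le x (th *: g x).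
  rewrite sqnormZ; have := qg x; have : th ^+ 2 * ((2 * B) ^+ 2 * q x) = q x / 4.
    by transitivity ((th * B) ^+ 2 * 4 * q x); [ring|rewrite thB; field].
  rewrite /x'; have := sqr_ge0 th; nra.
have ggg : ip (g (g x)) (g x) <= 2 * B * q (g x) by apply: ip_le_bound; rewrite ?qg//; lra.
have h2 : ip (g x') x' = ip (g x) x - 2 * th * q (g x) + th ^+ 2 * ip (g (g x)) (g x).
  by rewrite /x'; move: (g) lg sg => f lf sf;
    rewrite (linB _ _ lf) (linZ _ _ lf) !ipE (sf (f x) x) /q; ring.
exists x; split => //.
  have : e2 <= e by rewrite ge_min lexx.
  by nra.
(* The second order term costs only a quarter of the gain [2 * th * q (g x)]; by [h1] the rest of
   the gain is at most [5 * ga * q x]. *)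
have h3 : th ^+ 2 * ip (g (g x)) (g x) <= th / 2 * q (g x).
  have : th ^+ 2 * (2 * B * q (g x)) = th / 2 * q (g x).
    by transitivity (2 * th * (th * B) * q (g x)); [ring|rewrite thB; field].
  have := sqr_ge0 th; nra.
have h4 : th * q (g x) <= th * (e * q x).
  have : 10 * ga = e * th by rewrite /ga; field.
  by move: h1 h2 h3 qx''; nra.
by move: h4; rewrite ler_pM2l.
Qed.

Definition commutes (T S : V -> V) := forall x, T (S x) = S (T x).

(** By commutation [T x] undergoes the same perturbation as [x], with a correction of at most half
    its norm. This provides the condition of [approx_eigen] on the defect [q (T x)]. *)
Lemma defect_perturb (T a : V -> V) (B s : R) x :
  lin T -> commutes T a -> 0 < B -> (forall x, q (a x) <= B ^+ 2 * q x) ->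
  `|s| <= B -> q (T (x - (4 * B)^-1 *: (a x - s *: x))) <= 4 * q (T x).
Proof.
move=> lT cTa B0 aB sB.
rewrite (linB _ _ lT) (linZ _ _ lT) (linB _ _ lT) (linZ _ _ lT) cTa.
move: (T x) => z; set w := a z - s *: z.
have qw : q w <= (2 * B) ^+ 2 * q z.
  have h := sqnormB_le (a z) (s *: z); have := aB z; rewrite sqnormZ in h.
  have : s ^+ 2 <= B ^+ 2 by rewrite -real_normK ?num_real// lerXn2r// ?nnegrE// ltW.
  by have := ip_ge0 z; rewrite -/(q _) /w; nra.
have := sqnormB_le z ((4 * B)^-1 *: w); rewrite sqnormZ.
have : (4 * B)^-1 ^+ 2 * ((2 * B) ^+ 2 * q z) = q z / 4 by field; lra.
have := sqr_ge0 (4 * B)^-1; have := ip_ge0 z; rewrite -/(q _).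
move: (_^-1) (q (z - _)) => u v; nra.
Qed.

(** * Polynomial calculus for two commuting selfadjoint operators *)

Section TwoVariableCalculus.
Variables (a b : V -> V) (B : R).
Hypotheses (la : lin a) (lb : lin b) (sa : selfadjoint a) (sb : selfadjoint b).
Hypothesis (cab : commutes a b).
Hypothesis B0 : 0 < B.
Hypothesis aB : forall x, q (a x) <= B ^+ 2 * q x.
Hypothesis bB : forall x, q (b x) <= B ^+ 2 * q x.

(* [calc T f] stands for [T = f(a, b)]; the last field says that [T] acts as the
   scalar [f s t] on joint approximate eigenvectors. *)
Record calc (T : V -> V) (f : R -> R -> R) : Prop := Calc {
  calc_lin : lin T;
  calc_sa : selfadjoint T;
  calc_bdd : bdd T;
  calc_comm : forall S, lin S -> commutes a S -> commutes b S -> commutes T S;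
  calc_loc : forall s t, exists2 C, 0 <= C &
    forall x, q (T x - f s t *: x) <= C * (q (a x - s *: x) + q (b x - t *: x)) }.

Lemma calc1 : calc (fun x => x) (fun _ _ => 1).
Proof.
split=> //.
- by exists 1 => x; rewrite mul1r.
- move=> s t; exists 0 => // x; rewrite scale1r subrr mul0r /q.
  by rewrite ip0l.
Qed.

Lemma calca : calc a (fun s _ => s).
Proof.
split=> //; first by exists (B ^+ 2).
move=> s t; exists 1 => // x; rewrite mul1r lerDl; exact: ip_ge0.
Qed.

Lemma calcb : calc b (fun _ t => t).
Proof.
split=> //; first by exists (B ^+ 2).
move=> s t; exists 1 => // x; rewrite mul1r lerDr; exact: ip_ge0.
Qed.

Lemma calcD T S f g : calc T f -> calc S g ->
  calc (fun x => T x + S x) (fun s t => f s t + g s t).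
Proof.
move=> [lT sT bT cT kT] [lS sS bS cS kS]; split.
- by move=> c x y; rewrite lT lS scalerDr addrACA.
- by move=> x y; rewrite !ipE sT sS.
- have [M hM] := bT; have [N hN] := bS; exists (2 * M + 2 * N) => x.
  by have := sqnormD_le (T x) (S x); have := hM x; have := hN x; lra.
- by move=> U lU aU bU x; rewrite (linD _ _ lU) cT// cS.
- move=> s t; have [C C0 hC] := kT s t; have [D D0 hD] := kS s t.
  exists (2 * C + 2 * D) => [|x]; first lra.
  have -> : T x + S x - (f s t + g s t) *: x = (T x - f s t *: x) + (S x - g s t *: x).
    by rewrite scalerDl opprD addrACA.
  have := sqnormD_le (T x - f s t *: x) (S x - g s t *: x).
  by have := hC x; have := hD x; lra.
Qed.

Lemma calcZ c T f : calc T f -> calc (fun x => c *: T x) (fun s t => c * f s t).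
Proof.
move=> [lT sT bT cT kT]; split.
- by move=> d x y; rewrite lT scalerDr !scalerA mulrC.
- by move=> x y; rewrite !ipE sT.
- have [M hM] := bT; exists (c ^+ 2 * M) => x.
  by rewrite sqnormZ; have := ler_wpM2l (sqr_ge0 c) (hM x); lra.
- by move=> U lU aU bU x; rewrite (linZ _ _ lU) cT.
- move=> s t; have [C C0 hC] := kT s t.
  exists (c ^+ 2 * C) => [|x]; first by rewrite mulr_ge0 ?sqr_ge0.
  by rewrite -scalerA -scalerBr sqnormZ; have := ler_wpM2l (sqr_ge0 c) (hC x); lra.
Qed.

(** The product is selfadjoint because its factors commute: [S] commutes with [a] and [b], hence
    with [T] by [calc_comm]. *)
Lemma calcM T S f g : calc T f -> calc S g ->
  calc (fun x => T (S x)) (fun s t => f s t * g s t).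
Proof.
move=> [lT sT bT cT kT] [lS sS bS cS kS]; split.
- by move=> c x y; rewrite lS lT.
- move=> x y; rewrite sT sS; congr (ip x _); symmetry; apply: cT => //.
    by move=> z; rewrite cS.
  by move=> z; rewrite cS// => w; rewrite cab.
- have [M M0 hM] := bdd_ge0 bT; have [N hN] := bS; exists (M * N) => x.
  by rewrite -mulrA; apply: le_trans (hM _) _; apply: ler_wpM2l.
- by move=> U lU aU bU x; rewrite cS// cT.
- move=> s t; have [C C0 hC] := kT s t; have [D D0 hD] := kS s t.
  have [M M0 hM] := bdd_ge0 bT.
  exists (2 * (M * D) + 2 * (g s t ^+ 2 * C)) => [|x].
    by rewrite addr_ge0// mulr_ge0// mulr_ge0// sqr_ge0.
  have -> : T (S x) - (f s t * g s t) *: x =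
      T (S x - g s t *: x) + g s t *: (T x - f s t *: x).
    by rewrite (linB _ _ lT) (linZ _ _ lT) scalerBr scalerA (mulrC (g s t)) subrKA.
  apply: le_trans (sqnormD_le _ _) _; rewrite sqnormZ.
  have h1 := le_trans (hM _) (ler_wpM2l M0 (hD x)).
  have h2 := ler_wpM2l (sqr_ge0 (g s t)) (hC x).
  lra.
Qed.

Lemma calcB T S f g : calc T f -> calc S g ->
  calc (fun x => T x + (-1) *: S x) (fun s t => f s t + (-1) * g s t).
Proof. by move=> cT cS; apply: calcD => //; apply: calcZ. Qed.

Lemma calc_iter T f j : calc T f -> calc (iter j T) (fun s t => f s t ^+ j).
Proof.
move=> cT; elim: j => [|j ih]; first exact: calc1.
suff -> : (fun s t => f s t ^+ j.+1) = (fun s t => f s t * f s t ^+ j) by exact: calcM.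
by apply/funext => s; apply/funext => t; rewrite exprS.
Qed.

Lemma calc_sum (T : nat -> V -> V) (f : nat -> R -> R -> R) n :
  (forall j, calc (T j) (f j)) ->
  calc (fun x => \sum_(j < n) T j x) (fun s t => \sum_(j < n) f j s t).
Proof.
move=> cT; elim: n => [|n ih].
  have := calcZ 0 calc1; congr calc.
    by apply/funext => x; rewrite big_ord0 scale0r.
  by apply/funext => s; apply/funext => t; rewrite big_ord0 mul0r.
have := calcD ih (cT n); congr calc.
  by apply/funext => x; rewrite big_ord_recr.
by apply/funext => s; apply/funext => t; rewrite big_ord_recr.
Qed.

(* A negative value of the form would produce an approximate eigenvalue [tau < 0]
   of [T], refined successively to a joint one [(tau, s, t)] of [(T, a, b)];
   then [tau = f s t]. *)
Lemma calc_ge0 T f : calc T f ->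
  (forall s t, `|s| <= B -> `|t| <= B -> 0 <= f s t) ->
  forall x, 0 <= ip (T x) x.
Proof.
move=> [lT sT bT cT kT] f0 x0; rewrite leNgt; apply/negP => neg.
have qx0 : 0 < q x0.
  rewrite lt_neqAle ip_ge0 andbT eq_sym; apply/eqP => /ip_eq0 x00.
  by move: neg; rewrite x00 ipC ip0l ltxx.
have [M M0 hM] := bdd_ge0 bT.
have TB x : q (T x) <= (M + 1) ^+ 2 * q x.
  by have := hM x; have := ip_ge0 x; rewrite -/(q _); nra.
have M10 : 0 < M + 1 by lra.
(* With zero defect every vector is admissible, so [tau] is at most the Rayleigh quotient of [T] at
   [x0], which is negative. *)
have [||tau [_ tau1 tau2]] := @approx_eigen T (M + 1) (fun=> 0) lT sT M10 TB.
- by move=> s x _; rewrite mulr0.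
- by move=> e e0; exists x0 => //; rewrite mulr_ge0 ?ltW.
have {}tau2 : tau < 0.
  by have := tau2 x0 qx0 (lexx _); nra.
pose T' x := T x - tau *: x.
have lT' : lin T'.
  by move=> c x y; rewrite /T' lT !scalerDr !scalerN !scalerA (mulrC tau) opprD addrACA.
have cT'a : commutes T' a.
  by move=> x; rewrite /T' (linB _ _ la) (linZ _ _ la) cT// => y; rewrite cab.
have cT'b : commutes T' b.
  by move=> x; rewrite /T' (linB _ _ lb) (linZ _ _ lb) cT// => y; rewrite cab.
have [||s [sB s1 _]] := @approx_eigen a B (fun x => q (T' x)) la sa B0 aB.
- by move=> s x sB; apply: defect_perturb.
- by move=> e /tau1 [x [? _ ?]]; exists x.
pose a' x := a x - s *: x.
have la' : lin a'.
  by move=> c x y; rewrite /a' la !scalerDr !scalerN !scalerA (mulrC s) opprD addrACA.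
have ca'b : commutes a' b by move=> x; rewrite /a' (linB _ _ lb) (linZ _ _ lb) cab.
have [||t [tB t1 _]] := @approx_eigen b B (fun x => q (T' x) + q (a' x)) lb sb B0 bB.
- move=> t x tB; have := defect_perturb x lT' cT'b B0 bB tB.
  by have := defect_perturb x la' ca'b B0 bB tB; lra.
- move=> e e0; have e20 : 0 < e / 2 by rewrite divr_gt0.
  by have [x [x1 x2 x3]] := s1 _ e20; exists x => //; rewrite /a'; lra.
have [C C0 hC] := kT s t.
have fst0 := f0 s t sB tB.
(* This accuracy yields [(tau - f s t)^2 <= (4 C + 2) k < tau^2], against [tau < 0 <= f s t]. *)
pose k := (tau ^+ 2) / (4 + 4 * C).
have k0 : 0 < k by rewrite divr_gt0 ?exprn_even_gt0//=; [lra|lra].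
have [x [qx dx bx]] := t1 _ k0.
have := sqnormB_le (T x - f s t *: x) (T' x).
have -> : T x - f s t *: x - T' x = (tau - f s t) *: x.
  by rewrite /T' scalerBl opprB addrC addrA subrK.
rewrite sqnormZ => h.
have := hC x; have : q (a' x) <= k * q x by have := ip_ge0 (T' x); rewrite -/(q _); lra.
rewrite /a' => ax hx.
have Tx : q (T' x) <= k * q x by have := ip_ge0 (a' x); rewrite -/(q _); lra.
have {hx} hx : q (T x - f s t *: x) <= 2 * (C * (k * q x)) by nra.
have : (tau - f s t) ^+ 2 * q x <= (4 * C + 2) * k * q x by nra.
rewrite ler_pM2r// => {}h.
have : (4 * C + 4) * k = tau ^+ 2 by rewrite /k; field; lra.
nra.
Qed.

(* The largest such [c] is an outer measure of the rectangle for the spectral measure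
   of [(a, b)] at [u]; halving a rectangle keeps half of it on one side. *)
Definition heavy u s1 s2 t1 t2 (c : R) := forall T f, calc T f ->
  (forall s t, `|s| <= B -> `|t| <= B -> 0 <= f s t) ->
  (forall s t, `|s| <= B -> `|t| <= B -> s1 <= s <= s2 -> t1 <= t <= t2 -> 1 <= f s t) ->
  c <= ip (T u) u.

Lemma heavyPn u s1 s2 t1 t2 c : ~ heavy u s1 s2 t1 t2 c -> exists T f,
  [/\ calc T f, forall s t, `|s| <= B -> `|t| <= B -> 0 <= f s t,
   forall s t, `|s| <= B -> `|t| <= B -> s1 <= s <= s2 -> t1 <= t <= t2 -> 1 <= f s t
   & ip (T u) u < c].
Proof.
move=> nh; apply: contrapT => ne; apply: nh => T f cT f0 f1.
by rewrite leNgt; apply/negP => lt; apply: ne; exists T, f.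
Qed.

(** If [T] and [S] refute the two halves, then [T + S] is a test for the whole rectangle with form
    below [2 * c]. *)
Lemma heavy_split_fst u s1 m s2 t1 t2 c : heavy u s1 s2 t1 t2 (2 * c) ->
  heavy u s1 m t1 t2 c \/ heavy u m s2 t1 t2 c.
Proof.
move=> h; apply: contrapT => /not_orP[] /heavyPn[T [f [cT f0 f1 fu]]].
move=> /heavyPn[S [g [cS g0 g1 gu]]].
have := h _ _ (calcD cT cS); rewrite ipE => /(_ _ _)/wrap[].
- by move=> s t sB tB; rewrite addr_ge0 ?f0 ?g0.
- move=> s t sB tB /andP[s1s ss2] ht; have := f0 s t sB tB; have := g0 s t sB tB.
  have [sm|ms] := lerP s m.
    by have := f1 s t sB tB; rewrite s1s sm ht => /(_ isT isT); lra.
  by have := g1 s t sB tB; rewrite ss2 (ltW ms) ht => /(_ isT isT); lra.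
- lra.
Qed.

Lemma heavy_split_snd u s1 s2 t1 m t2 c : heavy u s1 s2 t1 t2 (2 * c) ->
  heavy u s1 s2 t1 m c \/ heavy u s1 s2 m t2 c.
Proof.
move=> h; apply: contrapT => /not_orP[] /heavyPn[T [f [cT f0 f1 fu]]].
move=> /heavyPn[S [g [cS g0 g1 gu]]].
have := h _ _ (calcD cT cS); rewrite ipE => /(_ _ _)/wrap[].
- by move=> s t sB tB; rewrite addr_ge0 ?f0 ?g0.
- move=> s t sB tB hs /andP[t1t tt2]; have := f0 s t sB tB; have := g0 s t sB tB.
  have [tm|mt] := lerP t m.
    by have := f1 s t sB tB; rewrite t1t tm hs => /(_ isT isT); lra.
  by have := g1 s t sB tB; rewrite tt2 (ltW mt) hs => /(_ isT isT); lra.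
- lra.
Qed.

Lemma heavy_quarter u (s t l c : R) : 0 <= l ->
  heavy u s (s + 2 * l) t (t + 2 * l) (4 * c) ->
  exists z : R * R, [/\ heavy u z.1 (z.1 + l) z.2 (z.2 + l) c,
    s <= z.1 <= s + l & t <= z.2 <= t + l].
Proof.
move=> l0; rewrite (_ : 4 * c = 2 * (2 * c)); last ring.
have E v : v + 2 * l = v + l + l by ring.
rewrite !{}E.
move=> /(heavy_split_fst (s + l)) H.
have {H}[s' sP] : exists2 s', s <= s' <= s + l &
    heavy u s' (s' + l) t (t + l + l) (2 * c).
  by case: H => H; [exists s|exists (s + l)] => //; apply/andP; split; lra.
move=> /(heavy_split_snd (t + l)) H.
have {H}[t' tP H] : exists2 t', t <= t' <= t + l &
    heavy u s' (s' + l) t' (t' + l) c.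
  by case: H => H; [exists t|exists (t + l)] => //; apply/andP; split; lra.
by exists (s', t').
Qed.

Lemma heavy_nested u : exists l1 l2,
  [/\ `|l1| <= B, `|l2| <= B & forall k, exists s t,
    [/\ heavy u s (s + 2 * B / 2 ^+ k) t (t + 2 * B / 2 ^+ k) (q u / 4 ^+ k),
      s <= l1 <= s + 2 * B / 2 ^+ k & t <= l2 <= t + 2 * B / 2 ^+ k]].
Proof.
pose L k := 2 * B / 2 ^+ k; pose c k := q u / 4 ^+ k.
have L0 k : 0 <= L k by rewrite /L divr_ge0 ?exprn_ge0 ?mulr_ge0 ?ltW.
have LS k : L k = 2 * L k.+1.
  by rewrite /L exprS; have := exprn_gt0 k (ltr0n R 2 : 0 < 2); move=> ?; field; lra.
have cS k : c k = 4 * c k.+1.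
  by rewrite /c exprS; have := exprn_gt0 k (ltr0n R 4 : 0 < 4); move=> ?; field; lra.
pose H k (z : R * R) := heavy u z.1 (z.1 + L k) z.2 (z.2 + L k) (c k).
(* Heaviness is a premise under the existential so that [choice] applies to all pairs; [0] is the
   junk value where it fails. *)
have step (kz : nat * (R * R)) : exists z : R * R, H kz.1 kz.2 ->
    [/\ H kz.1.+1 z, kz.2.1 <= z.1 <= kz.2.1 + L kz.1.+1 &
        kz.2.2 <= z.2 <= kz.2.2 + L kz.1.+1].
  case: kz => k z /=; have [hz|] := pselect (H k z); last by exists 0.
  move: hz; rewrite /H cS LS => /heavy_quarter[//|z' hz'].
  by exists z'.
have [F FP] := choice step.
pose fix z k : R * R := if k is k'.+1 then F (k', z k') else (- B, - B).
have zH k : H k (z k).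
  elim: k => [|k ih]; last by have [] := FP (k, z k) ih.
  (* The initial square is [[-B, B]^2], of full weight [q u]: a test is at least 1 on all of it, so
     [T - 1] is positive by [calc_ge0]. *)
  rewrite /H /L /c /= !expr0 !divr1 => T f cT f0 f1.
  have f1' s t : `|s| <= B -> `|t| <= B -> 0 <= f s t + -1 * 1.
    move=> sB tB; rewrite mulN1r subr_ge0; apply: f1 => //.
      by move: sB; rewrite ler_norml => /andP[? ?]; apply/andP; split; lra.
    by move: tB; rewrite ler_norml => /andP[? ?]; apply/andP; split; lra.
  by have := calc_ge0 (calcB cT calc1) f1' u; rewrite !ipE -/(q u); lra.
have zS k : [/\ (z k).1 <= (z k.+1).1 <= (z k).1 + L k.+1
    & (z k).2 <= (z k.+1).2 <= (z k).2 + L k.+1] by have [] := FP (k, z k) (zH k).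
have [|||l1 l1P] := @nested_point _ (fun k => (z k).1) (fun k => (z k).1 + L k).
- by move=> k; have [/andP[]] := zS k.
- by move=> k; have [/andP[]] := zS k; rewrite (LS k); lra.
- by move=> k; rewrite lerDl.
have [|||l2 l2P] := @nested_point _ (fun k => (z k).2) (fun k => (z k).2 + L k).
- by move=> k; have [_ /andP[]] := zS k.
- by move=> k; have [_ /andP[]] := zS k; rewrite (LS k); lra.
- by move=> k; rewrite lerDl.
have LE : L 0%N = 2 * B by rewrite /L expr0 divr1.
exists l1, l2; split.
- by have /andP[] := l1P 0%N; rewrite LE ler_norml /= => ? ?; apply/andP; split; lra.
- by have /andP[] := l2P 0%N; rewrite LE ler_norml /= => ? ?; apply/andP; split; lra.
- by move=> k; exists (z k).1, (z k).2; split; [exact: zH|exact: l1P|exact: l2P].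
Qed.

(* With [m = 8 B^2] and [q = |(a, b) - l|^2 / m], the test vectors are
   [W_n y] for [W_n = sum_(j < n) (1 - q)^j]: since [q W_n <= 1], the hypothesis
   bounds [<W_n y, y>] uniformly in [n]. On the other hand [(1 - q)^j >= 1/2] on a
   square of size [j^(-1/2)] around [l], so heaviness makes the sum diverge like
   the harmonic series. *)
Lemma resolvent_bound_eq0 y :
  (forall s t, exists C, forall x,
     ip x y ^+ 2 <= C * (q (a x - s *: x) + q (b x - t *: x))) -> y = 0.
Proof.
move=> yP; apply: ip_eq0; rewrite -/(q y).
have [l1 [l2 [l1B l2B hvy]]] := heavy_nested y.
have [C0 C0P] := yP l1 l2; pose C := `|C0|.
have CP x : ip x y ^+ 2 <= C * (q (a x - l1 *: x) + q (b x - l2 *: x)).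
  by apply: le_trans (C0P x) _; rewrite ler_wpM2r ?ler_norm// addr_ge0 ?ip_ge0.
have {C0P} C_ge0 : 0 <= C by rewrite /C.
clearbody C; clear C0.
(* Coordinates differ from [l1], [l2] by at most [2 B], so the squared distance is at most [8 B^2]
   and [f] takes values in [[0, 1]]. *)
pose m := 8 * B ^+ 2.
have m0 : 0 < m by rewrite /m mulr_gt0// exprn_gt0.
have ca1 := calcB calca (calcZ l1 calc1).
have cb1 := calcB calcb (calcZ l2 calc1).
have cT := calcB calc1 (calcZ m^-1 (calcD (calcM ca1 ca1) (calcM cb1 cb1))).
move: cT; set T := (T in calc T _); set f := (f in calc _ f) => cT.
have TE x : q (a x - l1 *: x) + q (b x - l2 *: x) = m * (q x - ip (T x) x).
  rewrite /T ipDl !ipZl ipDl (calc_sa ca1) (calc_sa cb1) !scaleN1r -!/(q _).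
  by field; rewrite gt_eqF.
have fE s t : f s t = 1 - ((s - l1) ^+ 2 + (t - l2) ^+ 2) / m.
  by rewrite /f; field; rewrite gt_eqF.
have f01 s t : `|s| <= B -> `|t| <= B -> 0 <= f s t <= 1.
  move: l1B l2B; rewrite !ler_norml => /andP[? ?] /andP[? ?] /andP[? ?] /andP[? ?].
  rewrite fE; set z := _ / m.
  have : 0 <= z by rewrite divr_ge0 ?addr_ge0 ?sqr_ge0// ltW.
  have : z <= 1.
    rewrite /z ler_pdivrMr// mul1r /m; have : (s - l1) ^+ 2 <= 4 * B ^+ 2 by nra.
    have : (t - l2) ^+ 2 <= 4 * B ^+ 2 by nra.
    lra.
  by move=> ? ?; apply/andP; split; lra.
clearbody T f.
pose W n x := \sum_(j < n) iter j T x.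
pose w n s t := \sum_(j < n) f s t ^+ j.
have cW n : calc (W n) (w n).
  by apply: (@calc_sum (fun j => iter j T) (fun j s t => f s t ^+ j)) => j; apply: calc_iter.
pose S n := ip (W n y) y.
have w0 n s t : `|s| <= B -> `|t| <= B -> 0 <= w n s t.
  by move=> sB tB; apply: sumr_ge0 => j _; have /andP[? _] := f01 s t sB tB; exact: exprn_ge0.
have S0 n : 0 <= S n by apply: calc_ge0 (cW n) _ _; exact: w0.
have SC n : S n <= C * m.
  (* The hypothesis on [y] at the vector [W n y], rewritten with [TE]. *)
  have h : S n ^+ 2 <= C * m * (ip (W n (W n y)) y - ip (W n (T (W n y))) y).
    rewrite (calc_sa (cW n) (W n y)) (calc_sa (cW n) (T _)) -mulrA -TE; exact: CP.
  (* Since [(1 - f) w = 1 - f^n], the symbol [w - (1 - f) w^2] equals [w f^n], which is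
     nonnegative. *)
  have h2 : ip (W n (W n y)) y - ip (W n (T (W n y))) y <= S n.
    have := calc_ge0 (calcB (cW n) (calcB (calcM (cW n) (cW n)) (calcM (cW n) (calcM cT (cW n))))) _ y.
    rewrite !ipE -/(S n) => /(_ _)/wrap[] => [s t sB tB|]; last lra.
    have /andP[f0 f1] := f01 s t sB tB.
    have -> : w n s t + -1 * (w n s t * w n s t + -1 * (w n s t * (f s t * w n s t))) =
      w n s t * (1 + (f s t - 1) * w n s t) by ring.
    have -> : 1 + (f s t - 1) * w n s t = f s t ^+ n by rewrite -subrX1 addrC subrK.
    by apply: mulr_ge0; [exact: w0|exact: exprn_ge0].
  have [Sn0|Sn0] := ltrP 0 (S n); last by apply: le_trans Sn0 _; rewrite mulr_ge0// ltW.
  have : S n * S n <= C * m * S n.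
    rewrite -expr2; apply: le_trans h _; rewrite ler_wpM2l// mulr_ge0// ltW//.
  by rewrite ler_pM2r.
have low j k : (2 * j <= 4 ^ k)%N -> q y / 4 ^+ k / 2 <= ip (iter j T y) y.
  move=> jk; have := hvy k; set X := 2 * B / 2 ^+ k => -[s0 [t0 [hs /andP[? ?] /andP[? ?]]]].
  (* [2 f^j] is a test for the [k]-th square: there [1 - f <= 2 X^2 / m = 4^-k], and Bernoulli with
     [2 j <= 4^k] gives [f^j >= 1/2]. *)
  have := hs _ _ (calcZ 2 (calc_iter j cT)); rewrite ipE.
  set Z := _ / _; move=> /(_ _ _)/wrap[] => [s t sB tB|s t sB tB /andP[? ?] /andP[? ?]|]; last lra.
    by rewrite mulr_ge0// exprn_ge0//; have /andP[] := f01 s t sB tB.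
  have := bernoulli_ge j (f01 s t sB tB).
  have k0 : 0 < 2 ^+ k :> R by rewrite exprn_gt0.
  have k40 : 0 < 4 ^+ k :> R by rewrite exprn_gt0.
  have k4 : 4 ^+ k = 2 ^+ k ^+ 2 :> R by rewrite -exprM mulnC exprM; congr (_ ^+ _); rewrite expr2; ring.
  have d : 1 - f s t <= (4 ^+ k)^-1.
    rewrite fE opprB addrC subrK ler_pdivrMr//.
    have -> : (4 ^+ k)^-1 * m = 2 * X ^+ 2.
      by rewrite /X k4 /m; field; rewrite gt_eqF.
    have sqr_le (u v : R) : - v <= u -> u <= v -> u ^+ 2 <= v ^+ 2 by nra.
    have : (s - l1) ^+ 2 <= X ^+ 2 by apply: sqr_le; lra.
    have : (t - l2) ^+ 2 <= X ^+ 2 by apply: sqr_le; lra.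
    lra.
  have : j%:R * (1 - f s t) <= 2^-1.
    have j0 : 0 <= j%:R :> R by [].
    apply: le_trans (ler_wpM2l j0 d) _; rewrite ler_pdivrMr//.
    have : (2 * j)%:R <= (4 ^ k)%:R :> R by rewrite ler_nat.
    by rewrite natrM natrX; lra.
  lra.
(* The block [4^K <= j < 4^(K+1)] has [3 * 4^K] terms. As [2 j <= 4^(K+2)], each is at least
   [q y / (2 * 4^(K+2))], so every block adds [3/32 * q y]. *)
have grow K : K%:R * (q y * 3 / 32) <= S (4 ^ K)%N.
  elim: K => [|K ih]; first by rewrite mul0r.
  have le4 : (4 ^ K <= 4 ^ K.+1)%N by rewrite leq_pexp2l.
  have -> : S (4 ^ K.+1)%N = S (4 ^ K)%N + \sum_(4 ^ K <= j < 4 ^ K.+1) ip (iter j T y) y.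
    have SE n : S n = \sum_(0 <= j < n) ip (iter j T y) y.
      rewrite big_mkord /S /W; elim/big_ind2 : _ => // [|u1 v1 u2 v2 <- <-].
        by rewrite ip0l.
      by rewrite ipDl.
    by rewrite !SE -big_cat_nat.
  have : \sum_(4 ^ K <= j < 4 ^ K.+1) (q y / 4 ^+ K.+2 / 2) <=
      \sum_(4 ^ K <= j < 4 ^ K.+1) ip (iter j T y) y.
    apply: ler_sum_nat => j /andP[_ jK]; apply: low.
    by rewrite (expnS 4 K.+1); lia.
  rewrite sumr_const_nat; have -> : (4 ^ K.+1 - 4 ^ K = 3 * 4 ^ K)%N by rewrite expnS; lia.
  rewrite -[_ *+ (3 * _)]mulr_natr natrM natrX !exprS.
  have k40 : 0 < 4 ^+ K :> R by rewrite exprn_gt0.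
  rewrite (_ : q y / _ / _ * _ = q y * 3 / 32); last by field; rewrite gt_eqF.
  by rewrite -natr1; lra.
apply/eqP; rewrite eq_le ip_ge0 andbT leNgt; apply/negP => qy0.
have c0 : 0 < q y * 3 / 32 by lra.
pose K := Num.Def.archi_bound (C * m / (q y * 3 / 32)).
have : C * m / (q y * 3 / 32) < K%:R by apply: archi_boundP; apply: divr_ge0; [apply: mulr_ge0|]; rewrite // ltW.
rewrite ltr_pdivrMr// => h.
by have := lt_le_trans h (le_trans (grow K) (SC _)); rewrite ltxx.
Qed.

End TwoVariableCalculus.
(** * Domination between operators *)

Definition dominated (F G : V -> V) := exists C, forall x, q (F x) <= C * q (G x).

Lemma dominated_refl F : dominated F F.
Proof. by exists 1 => x; rewrite mul1r. Qed.

Lemma dominatedD F F' G : dominated F G -> dominated F' G ->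
  dominated (fun x => F x + F' x) G.
Proof.
move=> [C hC] [D hD]; exists (2 * C + 2 * D) => x.
by have := sqnormD_le (F x) (F' x); have := hC x; have := hD x; lra.
Qed.

Lemma dominatedB F F' G : dominated F G -> dominated F' G ->
  dominated (fun x => F x - F' x) G.
Proof.
move=> [C hC] [D hD]; exists (2 * C + 2 * D) => x.
by have := sqnormB_le (F x) (F' x); have := hC x; have := hD x; lra.
Qed.

Lemma dominated_bdd T F G : bdd T -> dominated F G -> dominated (fun x => T (F x)) G.
Proof.
move=> /bdd_ge0[M M0 hM] [C hC]; exists (M * C) => x.
by apply: le_trans (hM _) _; rewrite -mulrA; apply: ler_wpM2l.
Qed.

Lemma dominated_comp S F G : dominated F G ->
  dominated (fun x => F (S x)) (fun x => G (S x)).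
Proof. by move=> [C hC]; exists C. Qed.

Lemma dominated_trans F G K : dominated F G -> dominated G K -> dominated F K.
Proof.
move=> [C hC] [D hD]; exists (`|C| * D) => x; apply: le_trans (hC x) _.
rewrite -mulrA; apply: le_trans (ler_wpM2l (normr_ge0 C) (hD x)).
by rewrite ler_wpM2r ?ler_norm ?ip_ge0.
Qed.

Lemma dominated_sum n (F : nat -> V -> V) G : (forall j, dominated (F j) G) ->
  dominated (fun x => \sum_(j < n) F j x) G.
Proof.
move=> h; elim: n => [|n [C hC]].
  exists 0 => x; rewrite big_ord0 mul0r /q.
  by rewrite ip0l.
have [D hD] := dominatedD (ex_intro _ C hC) (h n).
by exists D => x; rewrite big_ord_recr; exact: hD.
Qed.

(** This is [T^2 <= be T]: test the form on [x - be^-1 T x] and bound the second order term by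
    [<T (T x), T x> <= be |T x|^2]. *)
Lemma positive_sqnorm_le T be x : lin T -> selfadjoint T -> 0 < be ->
  (forall x, q (T x) <= be ^+ 2 * q x) -> (forall x, 0 <= ip (T x) x) ->
  q (T x) <= be * ip (T x) x.
Proof.
move=> lT sT be0 bT T0.
have h : ip (T (T x)) (T x) <= be * q (T x) by apply: ip_le_bound.
have := T0 (x - be^-1 *: T x); rewrite (linB _ _ lT) (linZ _ _ lT) !ipE.
rewrite (sT (T x) x) -/(q (T x)) => k.
have : be * be^-1 = 1 by field; lra.
move: (be^-1) k => v k v1.
have := ler_wpM2l (sqr_ge0 v) h.
have -> : v ^+ 2 * (be * q (T x)) = v * (be * v) * q (T x) by ring.
rewrite v1 mulr1 => h1.
have : v * q (T x) <= ip (T x) x by lra.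
by move=> /(ler_wpM2l (ltW be0)); rewrite mulrA v1 mul1r; lra.
Qed.

(** * Operators of class A(1,1) *)

Section ClassA.
Variables A As P : V -> V.
Hypotheses (lA : lin A) (lAs : lin As) (lP : lin P).
Hypotheses (adjA : forall x y, ip (A x) y = ip x (As y)) (saP : selfadjoint P).
Hypotheses (bA : bdd A) (bAs : bdd As) (bP : bdd P).
Hypothesis qP : forall x, q (P x) = q (A (A x)).
Hypothesis P_ge : forall x, 0 <= ip (P x - As (A x)) x.

(** [A (A x) = 0] forces [P x = 0], and then [P_ge] reads [0 <= - |A x|^2]. *)
Lemma classA_ker x : A (A x) = 0 -> A x = 0.
Proof.
move=> AAx; have := qP x; rewrite AAx {2}/q ip0l => /ip_eq0 Px.
have := P_ge x; rewrite Px !ipE (ipC (As _)) -adjA ip0l => h.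
by apply: ip_eq0; apply/eqP; rewrite eq_le ip_ge0 andbT; lra.
Qed.

(* With [R = P - A^* A >= 0] the identity
   [|P x - x|^2 + 2 <R x, x> = |A^2 x|^2 - 2 |A x|^2 + |x|^2] controls both terms on
   the left, and its right-hand side is of first order in [(A - 1)^* x] and of second
   order in [(A - 1) x]. *)
Lemma classA_dominated : dominated (fun x => As x - x) (fun x => A x - x).
Proof.
pose T x := P x - As (A x).
have lT : lin T.
  by move=> c x y; rewrite /T lP lA lAs scalerBr opprD addrACA.
have sT : selfadjoint T.
  by move=> x y; rewrite /T !ipE saP (ipC (As _)) -!adjA (ipC (A y)).
have bT : bdd T.
  exact: dominatedB bP (dominated_bdd bAs bA).
have [M M0 hM] := bdd_ge0 bT; pose be := M + 1.
have be0 : 0 < be by rewrite /be; lra.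
have qT x : q (T x) <= be * ip (T x) x.
  apply: positive_sqnorm_le => // z; have := hM z; have := ip_ge0 z.
  by rewrite -/(q _) /be; nra.
have [Ms Ms0 hMs] := bdd_ge0 bAs.
have [M2 M20 hM2] : exists2 M2, 0 <= M2 & forall x, q (A x - x) <= M2 * q x.
  apply: (@bdd_ge0 (fun x => A x - x)).
  exact: dominatedB bA (dominated_refl id).
(* [K] times the left side of the identity dominates [4 |P x - x|^2 + 4 |T x|^2], the second term by
   [qT]. *)
pose K := 4 + 2 * be.
exists (2 * (K * (2 + M2 + 2 * (1 + M2)) + 2 * K ^+ 2 + 2 * Ms)) => x.
set e := A x - x; set f := As x - x.
have Ax : A x = x + e by rewrite /e addrC subrK.
pose e2 := A e - e.
have AAx : A (A x) = x + e + (e + e2).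
  by rewrite (_ : e + e2 = A e) ?[e + _]addrC ?subrK// -Ax -(linD _ _ lA) -Ax.
(* Moving [A - 1] across the inner product makes [f] appear in the only term of the expansion that
   still involves [x]. *)
have fe : ip x e2 = ip f e.
  by rewrite /e2 /f ipDr ipNr ipDl ipNl (ipC (As x) e) -adjA (ipC (A e)).
have fE : f = (P x - x) - T x - As e.
  rewrite /T (_ : As (A x) = As x + As e); last by rewrite {1}Ax (linD _ _ lAs).
  by rewrite /f opprB (addrC (As x + _) (- _)) addrACA subrr add0r addrA addrK addrC.
have qe2 : q e2 <= M2 * q e by exact: hM2.
clearbody e2 e f.
have pi_de : q (P x - x) + 2 * ip (T x) x = q (A (A x)) - 2 * q (A x) + q x.
  rewrite -qP /T /q !ipE (ipC x (P x)) (ipC (As _) x) -adjA; ring.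
have kap : q (A (A x)) - 2 * q (A x) + q x =
    2 * q e + q e2 + 2 * ip f e + 4 * ip e e2.
  by rewrite AAx Ax -fe /q !ipE (ipC e x) (ipC e2 x) (ipC e2 e); ring.
have pi0 := ip_ge0 (P x - x); rewrite -/(q _) in pi0.
have de0 : 0 <= ip (T x) x by exact: P_ge.
have ee2 : 4 * ip e e2 <= 2 * q e + 2 * q e2.
  by have := ip_ge0 (e - e2); rewrite !ipE (ipC e2 e) /q; lra.
have qf : q f <= 4 * q (P x - x) + 4 * q (T x) + 2 * Ms * q e.
  have := sqnormB_le (P x - x - T x) (As e); rewrite -fE.
  by have := sqnormB_le (P x - x) (T x); have := hMs e; lra.
(* Weighted so that [2 K <f, e>] costs only half of [q f], which is absorbed on the left. *)
have KAM : 4 * K * ip f e <= q f + 4 * K ^+ 2 * q e.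
  by have := ip_ge0 (f - (2 * K) *: e); rewrite !ipE (ipC e f) /q; lra.
have qTx := qT x.
pose ka := 2 * q e + q e2 + 2 * ip f e + 4 * ip e e2.
have k1 : q (P x - x) + 2 * ip (T x) x = ka by rewrite pi_de kap.
have k2 : q f <= K * ka + 2 * Ms * q e by rewrite /K; nra.
have k3 : K * ka <= K * ((2 + M2 + 2 * (1 + M2)) * q e + 2 * ip f e).
  by apply: ler_wpM2l; rewrite /ka /K; [lra|lra].
lra.
Qed.

End ClassA.

End RealInnerProduct.

(** * Complex inner product spaces *)

(* [H] with scalars restricted to [R]. *)
Definition realified (R : realType) (H : lmodType R[i]) : Type := H.

Section Realified.
Variables (R : realType) (H : lmodType R[i]).

HB.instance Definition _ := GRing.Zmodule.copy (realified H) H.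

Definition real_scale (c : R) (x : realified H) : realified H := c%:C%C *: (x : H).

Fact real_scalerA a b x : real_scale a (real_scale b x) = real_scale (a * b) x.
Proof. by rewrite /real_scale scalerA rmorphM. Qed.

Fact real_scale1r : left_id 1 real_scale.
Proof. by move=> x; rewrite /real_scale scale1r. Qed.

Fact real_scalerDr : right_distributive real_scale +%R.
Proof. by move=> c x y; rewrite /real_scale -scalerDr. Qed.

Fact real_scalerDl x : {morph real_scale^~ x : a b / a + b}.
Proof. by move=> a b; rewrite /real_scale rmorphD -scalerDl. Qed.

HB.instance Definition _ := GRing.Zmodule_isLmodule.Build R (realified H)
  real_scalerA real_scale1r real_scalerDr real_scalerDl.

Lemma real_scaleE (c : R) (x : realified H) : c *: x = c%:C%C *: (x : H) :> H.
Proof. by []. Qed.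

End Realified.

Section ComplexInnerProduct.
Variables (R : realType) (H : lmodType R[i]) (ip : H -> H -> R[i]).
Hypothesis ipP : is_inner_product ip.

(** [ip x x] is real, so this real inner product has the same norm as [ip]. *)
Definition rip (x y : realified H) : R := complex.Re (ip x y).

Lemma cipDl x y z : ip (x + y) z = ip x z + ip y z.
Proof. by have [h _ _ _] := ipP; rewrite -{1}(scale1r x) h mul1r. Qed.

Lemma cip0l z : ip 0 z = 0.
Proof. by apply: (addIr (ip 0 z)); rewrite -cipDl !add0r. Qed.

Lemma cipZl c x z : ip (c *: x) z = c * ip x z.
Proof. by have [h _ _ _] := ipP; rewrite -(addr0 (c *: x)) h cip0l addr0. Qed.

Lemma cipC x y : ip y x = (ip x y)^*.
Proof. by have [_ h _ _] := ipP. Qed.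

Lemma cipZr c x z : ip x (c *: z) = c^* * ip x z.
Proof. by rewrite cipC cipZl rmorphM [in RHS](cipC z). Qed.

Lemma cipDr x y z : ip x (y + z) = ip x y + ip x z.
Proof. by rewrite cipC cipDl rmorphD (cipC y) (cipC z). Qed.

Lemma cipNl x z : ip (- x) z = - ip x z.
Proof. by rewrite -scaleN1r cipZl mulN1r. Qed.

Lemma cipNr x z : ip x (- z) = - ip x z.
Proof. by rewrite cipC cipNl rmorphN [in RHS](cipC z). Qed.

Lemma ripDl x y z : rip (x + y) z = rip x z + rip y z.
Proof. by rewrite /rip cipDl raddfD. Qed.

Lemma ripZl (c : R) x y : rip (c *: x) y = c * rip x y.
Proof. by rewrite /rip real_scaleE cipZl Re_mul /= mul0r subr0. Qed.

Lemma ripC x y : rip x y = rip y x.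
Proof. by rewrite /rip cipC conjE. Qed.

Lemma rip_ge0 x : 0 <= rip x x.
Proof. by have [_ _ h _] := ipP; have := h x; rewrite lecE => /andP[_]. Qed.

Lemma rip_eq0 x : rip x x = 0 -> x = 0.
Proof.
have [_ _ h h0] := ipP => rx; apply: h0; have := h x; rewrite lecE => /andP[/eqP ix _].
by apply/eqP; rewrite eq_complex /= -/(rip x x) rx ix !eqxx.
Qed.

Lemma ripZ (c : R[i]) (x : H) : rip (c *: x) (c *: x) =
  (complex.Re c ^+ 2 + complex.Im c ^+ 2) * rip x x.
Proof.
rewrite /rip cipZl cipZr mulrA Re_mul conjE; case: c => a b /=.
move: (complex.Re _) (complex.Im _) => u v; ring.
Qed.

Lemma hnorm_le M x y : hnorm ip x <= M * hnorm ip y -> rip x x <= M ^+ 2 * rip y y.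
Proof.
rewrite /hnorm => h; have := h; rewrite -(@ler_sqr _ (Num.sqrt _)) ?nnegrE ?sqrtr_ge0//.
  by rewrite exprMn !sqr_sqrtr ?rip_ge0.
exact: le_trans (sqrtr_ge0 _) h.
Qed.

Local Notation dominated F G := (@dominated R (realified H) rip F G).

Lemma dominatedZ c (F G : H -> H) : dominated F G -> dominated (fun x => c *: F x) G.
Proof.
move=> [C hC]; exists ((complex.Re c ^+ 2 + complex.Im c ^+ 2) * C) => x.
by rewrite ripZ -mulrA ler_wpM2l// addr_ge0// sqr_ge0.
Qed.

Lemma adjoint_eq T Ts Ts' : is_adjoint ip T Ts -> is_adjoint ip T Ts' -> Ts =1 Ts'.
Proof.
move=> h h' y; apply/eqP; rewrite -subr_eq0; apply/eqP; have [_ _ _ h0] := ipP.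
by apply: h0; rewrite cipDr cipNr -h -h' subrr.
Qed.

Lemma adjoint_sym T Ts x y : is_adjoint ip T Ts -> ip (Ts x) y = ip x (T y).
Proof. by move=> h; rewrite cipC -h [in RHS](cipC (T y)). Qed.

Lemma adjoint_linear T Ts : is_adjoint ip T Ts -> is_linear_op Ts.
Proof.
move=> h c x y; apply/eqP; rewrite -subr_eq0; apply/eqP; have [_ _ _ h0] := ipP.
by apply: h0; rewrite cipDr cipNr -h !cipDr !cipZr -!h subrr.
Qed.

Lemma rip_adjoint T Ts (x y : realified H) : is_adjoint ip T Ts -> rip (T x) y = rip x (Ts y).
Proof. by move=> h; rewrite /rip h. Qed.

Lemma bounded_bdd T : bounded_op ip T -> @bdd R (realified H) rip T.
Proof. by move=> [_ [M hM]]; exists (M ^+ 2) => x; apply: hnorm_le. Qed.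

Lemma linear_lin T : is_linear_op T -> @lin R (realified H) T.
Proof. by move=> h c x y; rewrite real_scaleE h. Qed.

Local Notation bdd := (@bdd R (realified H) rip).
Local Notation commutes := (@commutes R (realified H)).

(** Cauchy-Schwarz on [|T^* x|^2 = <T T^* x, x>] gives [|T^* x|^4 <= M |T^* x|^2 |x|^2]; then
    cancel. *)
Lemma adjoint_bdd T Ts : is_adjoint ip T Ts -> bdd T -> bdd Ts.
Proof.
move=> h bT; have [M M0 hM] := bdd_ge0 rip_ge0 bT; exists M => x.
have [y0|y0] := eqVneq (rip (Ts x) (Ts x)) 0.
  by rewrite y0 mulr_ge0// rip_ge0.
have yp : 0 < rip (Ts x) (Ts x) by rewrite lt_neqAle eq_sym y0 rip_ge0.
have := ip_sqr_le ripDl ripZl ripC rip_ge0 rip_eq0 (T (Ts x)) x.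
rewrite (rip_adjoint _ _ h) => k; have := hM (Ts x).
move=> /(ler_wpM2r (rip_ge0 x)) /(le_trans k).
set r := rip (Ts x) _ in yp *; have -> : M * r * rip x x = r * (M * rip x x) by ring.
by rewrite expr2 ler_pM2l.
Qed.

Lemma commutes_comb T N Ns (k l : R[i]) : is_linear_op T -> commutes T N -> commutes T Ns ->
  commutes T (fun x : H => k *: (N x + l *: Ns x) : H).
Proof.
move=> lT cN cNs x; have lT' := linear_lin lT.
have T0 : T 0 = 0 by exact: (lin0 lT').
have TZ c z : T (c *: z) = c *: T z by have := lT c z 0; rewrite T0 !addr0.
by rewrite TZ (linD _ _ lT') TZ cN cNs.
Qed.

Lemma linear_comb N Ns (k l : R[i]) : is_linear_op N -> is_linear_op Ns ->
  is_linear_op (fun x : H => k *: (N x + l *: Ns x)).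
Proof.
move=> lN lNs c x y; rewrite lN lNs !scalerDr !scalerA addrACA.
by rewrite (mulrC k c) (mulrC (k * l) c) !mulrA.
Qed.

(** Write [N = a + i b] with [a], [b] selfadjoint, commuting by normality. For [mu = s + i t],
    [|(N - mu) x|^2] is at most twice the joint defect in [resolvent_bound_eq0]. *)
Lemma normal_resolvent_eq0 N Ns y : is_linear_op N -> bdd N ->
  is_adjoint ip N Ns -> (forall x, Ns (N x) = N (Ns x)) ->
  (forall mu : R[i], exists C, forall x : H,
    rip x y ^+ 2 <= C * rip (N x - mu *: x) (N x - mu *: x)) -> y = 0.
Proof.
move=> lN bN adj nN yP.
have lNs := adjoint_linear adj; have bNs := adjoint_bdd adj bN.
(* [h = 1/2] and [k = 1/(2i)], the coefficients of the real and imaginary parts of [N]. *)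
pose h : R[i] := (2^-1 : R)%:C%C; pose k : R[i] := Complex 0 (- 2^-1).
pose a (x : realified H) : realified H := (h *: (N x + 1 *: Ns x) : H).
pose b (x : realified H) : realified H := (k *: (N x + (-1) *: Ns x) : H).
have la : is_linear_op a by exact: linear_comb.
have lb : is_linear_op b by exact: linear_comb.
have cab : commutes a b.
  have cN : commutes a N by move=> x; symmetry; apply: (@commutes_comb N N Ns) => // z; rewrite nN.
  have cNs : commutes a Ns.
    by move=> x; symmetry; apply: (@commutes_comb Ns N Ns).
  exact: (@commutes_comb a N Ns k (-1)).
have adj' x z : ip (Ns x) z = ip x (N z) by exact: adjoint_sym.
have sa : selfadjoint rip a.
  move=> x z; rewrite /rip /a cipZl cipZr !cipDr !cipDl !scale1r adj adj' conjE.
  by rewrite /h /= oppr0 addrC.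
have sb : selfadjoint rip b.
  move=> x z; rewrite /rip /b cipZl cipZr !cipDr !cipDl !scaleN1r !cipNl !cipNr adj adj'.
  by rewrite !Re_mul conjE /k /= !raddfB /= !mul0r !sub0r; ring.
have ba : bdd a.
  by apply: dominatedZ; apply: (dominatedD ripDl ripZl ripC rip_ge0 bN); apply: dominatedZ.
have bb : bdd b.
  by apply: dominatedZ; apply: (dominatedD ripDl ripZl ripC rip_ge0 bN); apply: dominatedZ.
have [Ma Ma0 hMa] := bdd_ge0 rip_ge0 ba; have [Mb Mb0 hMb] := bdd_ge0 rip_ge0 bb.
pose B := Ma + Mb + 1.
have B0 : 0 < B by rewrite /B; lra.
have aB x : rip (a x) (a x) <= B ^+ 2 * rip x x.
  by apply: le_trans (hMa x) _; apply: ler_wpM2r; [exact: rip_ge0|rewrite /B; nra].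
have bB x : rip (b x) (b x) <= B ^+ 2 * rip x x.
  by apply: le_trans (hMb x) _; apply: ler_wpM2r; [exact: rip_ge0|rewrite /B; nra].
apply: (resolvent_bound_eq0 ripDl ripZl ripC rip_ge0 rip_eq0 (linear_lin la)
  (linear_lin lb) sa sb cab B0 aB bB) => s t.
have [C hC] := yP (Complex s t); exists (`|C| * 2) => x.
apply: le_trans (hC x) _; set u := a x - s *: x; set v := b x - t *: x.
have -> : N x - Complex s t *: x = u + ('i%C : R[i]) *: (v : H).
  rewrite /u /v /a /b !real_scaleE scalerBr !scalerA !scale1r !scaleN1r addrACA -opprD.
  congr (_ - _).
    have -> : ('i * k)%C = h
      by apply/eqP; rewrite eq_complex /h /k /=; apply/andP; split; apply/eqP; ring.
    rewrite -scalerDr addrACA subrr addr0 -mulr2n -scaler_nat scalerA.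
    by rewrite mulVf ?pnatr_eq0// scale1r.
  have -> : Complex s t = s%:C%C + 'i%C * t%:C%C.
    by apply/eqP; rewrite eq_complex /=; apply/andP; split; apply/eqP; ring.
  exact: scalerDl.
set w := u + _.
apply: (@le_trans _ _ (`|C| * rip w w)); first by rewrite ler_wpM2r ?ler_norm ?rip_ge0.
rewrite -mulrA ler_wpM2l//.
have := sqnormD_le ripDl ripZl ripC rip_ge0 u ('i%C *: (v : H) : realified H).
by rewrite ripZ /= expr0n expr1n add0r mul1r mulrDr.
Qed.

Lemma dominated_ext (F F' G G' : H -> H) : F =1 F' -> G =1 G' ->
  dominated F G -> dominated F' G'.
Proof. by move=> eF eG [C hC]; exists C => x; rewrite -eF -eG. Qed.

Lemma linear_opB (T : H -> H) x y : is_linear_op T -> T (x - y) = T x - T y.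
Proof. by move=> lT; exact: (linB _ _ (linear_lin lT)). Qed.

Lemma linear_opZ (T : H -> H) c x : is_linear_op T -> T (c *: x) = c *: T x.
Proof.
move=> lT; have := lT c x 0.
by rewrite (lin0 (linear_lin lT) : T 0 = 0) !addr0.
Qed.

Lemma linear_op_sum (T : H -> H) n (F : nat -> H) : is_linear_op T ->
  T (\sum_(k < n) F k) = \sum_(k < n) T (F k).
Proof.
move=> lT; apply: (big_morph T) => [x y|]; last exact: (lin0 (linear_lin lT)).
exact: (linD _ _ (linear_lin lT)).
Qed.

Lemma linear_iter (T : H -> H) n : is_linear_op T -> is_linear_op (iter n T).
Proof. by move=> lT; elim: n => // n ih c x y /=; rewrite ih lT. Qed.

(** * Roots of normal operators *)

Section RootOfNormal.
Variables A As : H -> H.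
Hypotheses (lA : is_linear_op A) (bA : bdd A) (adjA : is_adjoint ip A As).
Hypothesis dom : forall l : R[i], l != 0 ->
  dominated (fun x => As x - l^* *: x) (fun x => A x - l *: x).

Let lAs : is_linear_op As := adjoint_linear adjA.
Let bAs : bdd As := adjoint_bdd adjA bA.
Let D x := A (As x) - As (A x).

Let bdd_shift (T : H -> H) (l : R[i]) : bdd T -> bdd (fun x => T x - l *: x : H).
Proof.
move=> bT; apply: (dominatedB ripDl ripZl ripC rip_ge0 bT).
exact: (@dominatedZ l id id (dominated_refl _ _)).
Qed.

Let commutator_linear : is_linear_op D.
Proof. by move=> c x y; rewrite /D !(lA, lAs) scalerBr opprD addrACA. Qed.

(** The commutator is unchanged by the shift: [D = (A - l)(A - l)^* - (A - l)^*(A - l)]. Dominance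
    controls the first product, boundedness the second. *)
Lemma commutator_dominated (l : R[i]) : l != 0 -> dominated D (fun x => A x - l *: x).
Proof.
move=> l0; have h1 := dominated_bdd rip_ge0 (bdd_shift l bA) (dom l0).
have h2 := dominated_bdd rip_ge0 (bdd_shift l^* bAs) (dominated_refl rip (fun x : realified H => A x - l *: x : H)).
apply: dominated_ext (dominatedB ripDl ripZl ripC rip_ge0 h1 h2) => // x.
rewrite /D (linear_opB _ _ lA) (linear_opB _ _ lAs) (linear_opZ _ _ lA) (linear_opZ _ _ lAs).
rewrite !scalerBr !scalerA (mulrC l^*).
move: (A (As x)) (As (A x)) (l^* *: A x) (l *: As x) ((l * l^*) *: x) => p r u v w.
rewrite -[p - u - _]addrA -opprD -[r - v - _]addrA -opprD (addrCA v).
by move: (u + _) => s; rewrite opprB addrA subrK.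
Qed.

(* [x = sum_j x_j] with [x_j = n^-1 sum_(k < n) l_j^-k A^k x] over the [n]-th roots
   [l_j] of [mu], and [(A - l_j) x_j] is a multiple of [(A^n - mu) x]. *)
Lemma commutator_dominated_iter n (mu : R[i]) : (0 < n)%N -> mu != 0 ->
  dominated D (fun x => iter n A x - mu *: x).
Proof.
move=> n0 mu0.
have [z zP] := prim_root_exists R[i] n0.
pose l := n.-root mu.
have ln : l ^+ n = mu by rewrite /l rootCK.
have l0 : l != 0 by apply: contraNneq mu0 => l0; rewrite -ln l0 expr0n gtn_eqF.
have z0 : z != 0.
  by apply/eqP => z0; have := prim_expr_order zP; rewrite z0 expr0n gtn_eqF// => /eqP; rewrite eq_sym oner_eq0.
pose lj j := l * (z^-1) ^+ j.
have lj0 j : lj j != 0 by rewrite mulf_neq0// expf_neq0// invr_eq0.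
have ljn j : lj j ^+ n = mu.
  by rewrite exprMn ln exprAC exprVn (prim_expr_order zP) invr1 expr1n mulr1.
have nz : n%:R != 0 :> R[i] by rewrite pnatr_eq0 -lt0n.
pose xj j (x : H) := n%:R^-1 *: \sum_(k < n) (lj j)^-1 ^+ k *: iter k A x.
have sum_xj x : \sum_(j < n) xj j x = x.
  rewrite /xj -scaler_sumr exchange_big /=.
  under eq_bigr => k _ do rewrite -scaler_suml.
  rewrite (bigD1 (Ordinal n0))//= [X in _ + X]big1 ?addr0.
    rewrite scalerA [X in _ * X](_ : _ = n%:R) ?mulVf ?scale1r//.
    by rewrite (eq_bigr (fun=> 1)) => [|j _]; [rewrite sumr_const card_ord|exact: expr0].
  (* For [k > 0] the coefficient of [A^k x] is a multiple of the sum of [z^(jk)] over [j], which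
     vanishes. *)
  move=> k k0; under eq_bigr => j _ do rewrite /lj invfM -exprVn invrK exprMn.
  rewrite -mulr_sumr sum_prim_root// ?mulr0 ?scale0r//.
  by rewrite ltn_ord andbT lt0n; apply: contraNneq k0 => k0; apply/eqP/val_inj.
have A_xj j x : A (xj j x) - lj j *: xj j x =
    (n%:R^-1 * lj j * mu^-1) *: (iter n A x - mu *: x).
  rewrite /xj (linear_opZ _ _ lA) (linear_op_sum _ (fun k => (lj j)^-1 ^+ k *: iter k A x) lA).
  rewrite scalerA (mulrC (lj j)) -[in LHS]scalerA -scalerBr -[RHS]scalerA -[RHS]scalerA; congr (_ *: _).
  transitivity (lj j *: (\sum_(0 <= k < n) ((lj j)^-1 ^+ k.+1 *: iter k.+1 A x - (lj j)^-1 ^+ k *: iter k A x))).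
    rewrite big_mkord sumrB scalerBr [in RHS]scaler_sumr; congr (_ - _); apply: eq_bigr => k _.
    by rewrite (linear_opZ _ _ lA) scalerA exprS mulrA mulfV// mul1r.
  rewrite (telescope_sumr (fun k => (lj j)^-1 ^+ k *: iter k A x))//= expr0 scale1r exprVn ljn.
  by congr (_ *: _); rewrite scalerBr scalerA mulVf// scale1r.
have DE x : D x = \sum_(j < n) D (xj j x).
  by rewrite -(linear_op_sum _ (fun j => xj j x) commutator_linear) sum_xj.
apply: (dominated_ext (fun x => esym (DE x)) (fun=> erefl)).
apply: (@dominated_sum R (realified H) rip ripDl ripZl ripC rip_ge0 n (fun j x => D (xj j x))) => j.
apply: (@dominated_trans R (realified H) rip rip_ge0 _ (fun x : H => A (xj j x) - lj j *: xj j x : H)).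
  exact: (@dominated_comp R (realified H) rip (xj j) _ _ (commutator_dominated (lj0 j))).
apply: (dominated_ext (fun x => esym (A_xj j x)) (fun=> erefl)).
exact/dominatedZ/dominated_refl.
Qed.

Hypothesis kerA : forall x, A (A x) = 0 -> A x = 0.

Lemma root_of_normal n : (0 < n)%N -> normal_op ip (iter n A) ->
  forall x, As (A x) = A (As x).
Proof.
move=> n0 [Ns [adjN nN]].
set N := iter n A in adjN nN.
have lN : is_linear_op N by exact: linear_iter.
have bN : bdd N.
  rewrite /N; elim: n {n0 N adjN nN lN} => [|n ih]; first exact: dominated_refl.
  exact: (dominated_bdd rip_ge0 bA ih).
have bD : bdd D.
  by apply: (dominatedB ripDl ripZl ripC rip_ge0); apply: (dominated_bdd rip_ge0).
have saD x y : ip (D x) y = ip x (D y).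
  by rewrite /D cipDl cipNl cipDr cipNr (adjA (As x)) (adjoint_sym (A x) y adjA) -(adjA x (A y)) -(adjoint_sym x (As y) adjA).
(* For [mu != 0], apply the bound on [D] at [N x] and use that [N] commutes with [N - mu]; for
   [mu = 0], boundedness of [D] suffices. *)
have DN (mu : R[i]) : dominated (fun x => D (N x)) (fun x => N x - mu *: x).
  have [->|mu0] := eqVneq mu 0.
    apply: (dominated_ext (G := N) (fun=> erefl)) => [x|]; first by rewrite scale0r subr0.
    exact: (dominated_bdd rip_ge0 bD (dominated_refl _ _)).
  apply: (@dominated_trans R (realified H) rip rip_ge0 _ (fun x : H => N (N x) - mu *: N x : H)).
    exact: (@dominated_comp R (realified H) rip N _ _ (commutator_dominated_iter n0 mu0)).
  apply: (dominated_ext (F := fun x => N (N x - mu *: x)) _ (fun=> erefl)).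
    by move=> x; rewrite (linear_opB _ _ lN) (linear_opZ _ _ lN).
  exact: (dominated_bdd rip_ge0 bN (dominated_refl _ _)).
(* [<x, N^* D z> = <D N x, z>], so [DN] gives the resolvent bound for the vector [N^* D z]. *)
have NsD z : Ns (D z) = 0.
  apply: (normal_resolvent_eq0 lN bN adjN nN) => mu.
  have [C hC] := DN mu; exists (C * rip z z) => x.
  rewrite -(rip_adjoint _ _ adjN) /rip -saD -/(rip _ _).
  apply: le_trans (ip_sqr_le ripDl ripZl ripC rip_ge0 rip_eq0 _ _) _.
  by rewrite [leRHS]mulrAC; apply: ler_wpM2r; [exact: rip_ge0|exact: hC].
have ND z : N (D z) = 0.
  apply: rip_eq0; rewrite (rip_adjoint _ _ adjN) nN NsD (lin0 (linear_lin lN)).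
  by rewrite ripC (ip0l ripZl).
have kerN m x : iter m.+1 A x = 0 -> A x = 0.
  by elim: m => // m ih /=; rewrite -iterS => /kerA/ih.
have AD z : A (D z) = 0 by apply: (kerN n.-1); rewrite prednK.
have A0 : A 0 = 0 by exact: (lin0 (linear_lin lA)).
have As0 : As 0 = 0 by exact: (lin0 (linear_lin lAs)).
(* As [A D = 0], [D (D z)] is [A A^* D z], and [A] kills it; [kerA] then gives [A A^* D z = 0]. *)
have AsD z : As (D z) = 0.
  have AAs : A (As (D z)) = 0.
    apply: kerA; have := AD (D z); rewrite {1}/D AD As0 subr0; exact.
  by apply: rip_eq0; rewrite -(rip_adjoint _ _ adjA) AAs (ip0l ripZl).
move=> x; apply/esym/eqP; rewrite -subr_eq0; apply/eqP; rewrite -/(D x).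
apply: rip_eq0; rewrite /rip saD {1}/D AD AsD A0 As0 subr0 -/(rip _ _).
by rewrite ripC (ip0l ripZl).
Qed.

End RootOfNormal.

(** * The dominant case and the class A(1,1) case *)

Lemma adjoint_shift A As (l : R[i]) : is_adjoint ip A As ->
  is_adjoint ip (shift_op A l) (fun x => As x - l^* *: x).
Proof.
move=> h x y; rewrite /shift_op cipDl cipNl cipDr cipNr cipZl cipZr h.
by have -> : l^*^* = l by exact: conjCK.
Qed.

(** Dominance at [0] supplies the adjoint and [|A^* y| <= M |A y|]; at [y = A x] this gives
    [kerA]. *)
Lemma dominant_normal A n : (0 < n)%N -> bounded_op ip A -> normal_op ip (iter n A) ->
  dominant ip A -> normal_op ip A.
Proof.
move=> n0 bA nA dA; have [As [adj0 [M [M0 hM]]]] := dA 0.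
have adj : is_adjoint ip A As.
  by move=> x y; rewrite -adj0 /shift_op scale0r subr0.
exists As; split=> //; apply: (root_of_normal (proj1 bA) (bounded_bdd bA) adj _ _ n0 nA).
  move=> l _; have [Ts [adjT [C [_ hC]]]] := dA l.
  exists (C ^+ 2) => x; rewrite -(adjoint_eq adjT (adjoint_shift l adj)).
  exact/hnorm_le/hC.
move=> x AAx; apply: rip_eq0; rewrite (rip_adjoint _ _ adj).
have := hnorm_le (hM (A x)); rewrite /shift_op scale0r subr0 AAx (ip0l ripZl) mulr0 => h.
suff -> : As (A x) = 0 by rewrite ripC (ip0l ripZl).
by apply: rip_eq0; apply/eqP; rewrite eq_le h rip_ge0.
Qed.

(* The form of [P] is real on [x + i y]. *)
Lemma positive_selfadjoint (P : H -> H) : is_linear_op P -> positive_op ip P ->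
  selfadjoint rip P.
Proof.
move=> lP P0 x y; have PIm z : complex.Im (ip (P z) z) = 0.
  by have := P0 z; rewrite lecE => /andP[/eqP].
have := PIm ('i%C *: (y : H) + x); rewrite lP !cipDl !cipDr !cipZl !cipZr !raddfD /= !PIm.
rewrite [rip x _]ripC /rip conjE /=.
case: (ip (P x) y) (ip (P y) x) (ip (P y) y) (PIm y) => [a b] [c d] [e f] /= ->; lra.
Qed.

(** Rescaling reduces to [l = 1]: [A / l] is again of class A(1,1), with [P / |l|^2] in place of
    [P]. *)
Lemma classA_dominated_shift A As P (l : R[i]) : l != 0 ->
  bounded_op ip A -> is_adjoint ip A As -> bounded_op ip P -> positive_op ip P ->
  (forall x, P (P x) = As (As (A (A x)))) ->
  positive_op ip (fun x => P x - As (A x)) ->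
  dominated (fun x => As x - l^* *: x) (fun x => A x - l *: x).
Proof.
move=> l0 bA adj bP P0 PP PA.
have lA := proj1 bA; have lAs := adjoint_linear adj; have lP := proj1 bP.
have sP := positive_selfadjoint lP P0.
pose k := l^-1; pose m := k^* * k.
pose A' (x : H) : H := k *: A x; pose As' (x : H) : H := k^* *: As x; pose P' (x : H) : H := m *: P x.
have mE : m = (complex.Re m)%:C%C.
  by rewrite /m conjE; case: (k) => a b; apply/eqP; rewrite eq_complex /= eqxx /=; apply/eqP; ring.
have PE z : P' z = complex.Re m *: (P z : realified H) by rewrite /P' {1}mE.
have m_ge0 : 0 <= complex.Re m.
  by rewrite /m conjE; case: (k) => a b /=; nra.
have linZ' c (T : H -> H) : is_linear_op T -> is_linear_op (fun x => c *: T x).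
  by move=> lT a x y; rewrite lT scalerDr !scalerA mulrC.
have main : dominated (fun x => As' x - x) (fun x => A' x - x).
  apply: (@classA_dominated R (realified H) rip ripDl ripZl ripC rip_ge0 A' As' P').
  - exact/linear_lin/linZ'.
  - exact/linear_lin/linZ'.
  - exact/linear_lin/linZ'.
  - move=> x y; rewrite /rip /A' /As' cipZl cipZr adj; congr (complex.Re (_ * _)).
    by apply/esym; exact: conjCK.
  - by move=> x y; rewrite !PE ripZl sP [RHS]ripC ripZl (ripC (P y)).
  - exact/dominatedZ/bounded_bdd.
  - exact/dominatedZ/(adjoint_bdd adj)/bounded_bdd.
  - exact/dominatedZ/bounded_bdd.
  - move=> x; rewrite /P' /A' (linear_opZ _ _ lA) !ripZ.
    have -> : rip (P x) (P x) = rip (A (A x)) (A (A x)).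
      by rewrite sP PP -!(rip_adjoint _ _ adj).
    rewrite mulrA; congr (_ * _); rewrite mE /= /m conjE; case: (k) => a b /=; ring.
  - move=> x.
    have -> : P' x - As' (A' x) = complex.Re m *: (P x - As (A x) : realified H).
      rewrite scalerBr PE; congr (_ - _).
      by rewrite /As' /A' (linear_opZ _ _ lAs) scalerA -/m {1}mE.
    by rewrite ripZl mulr_ge0//; have := PA x; rewrite lecE => /andP[].
have [C hC] := dominatedZ l^* main.
apply: (@dominated_trans R (realified H) rip rip_ge0 _ (fun x : H => A' x - x : H)).
  exists C => x; apply: le_trans (hC x); rewrite /As' scalerBr scalerA -rmorphM mulfV// rmorph1.
  by rewrite scale1r.
apply: (dominated_ext (F := fun x => k *: (A x - l *: x)) _ (fun=> erefl)).
  by move=> x; rewrite scalerBr scalerA mulVf// scale1r.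
exact/dominatedZ/dominated_refl.
Qed.

Lemma classA_normal A n : (0 < n)%N -> bounded_op ip A -> normal_op ip (iter n A) ->
  classA11 ip A -> normal_op ip A.
Proof.
move=> n0 bA nA [As [adj [P [bP P0 PP PA]]]].
exists As; split=> //; apply: (root_of_normal (proj1 bA) (bounded_bdd bA) adj _ _ n0 nA).
  by move=> l l0; apply: (classA_dominated_shift l0 bA adj bP).
have sP := positive_selfadjoint (proj1 bP) P0.
apply: (@classA_ker R (realified H) rip ripDl ripZl ripC rip_ge0 rip_eq0 A As P).
- by move=> x y; exact: rip_adjoint.
- by move=> x; rewrite sP PP -!(rip_adjoint _ _ adj).
- by move=> x; have := PA x; rewrite lecE => /andP[].
Qed.

End ComplexInnerProduct.

Theorem theorem3p9 (R : realType) (H : lmodType R[i]) (ip : H -> H -> R[i])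
  (hH : is_hilbert ip) (hinf : infinite_dim H) (n : nat) (hn : (1 < n)%N)
  (A : H -> H) (hA : bounded_op ip A) (hAn : normal_op ip (iter n A)) :
  dominant ip A \/ classA11 ip A -> normal_op ip A.
Proof.
have n0 : (0 < n)%N by exact: ltnW.
have [ipP _] := hH.
by case=> h; [exact: (dominant_normal ipP n0 hA hAn h)|exact: (classA_normal ipP n0 hA hAn h)].
Qed.
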